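(* Let $n,k$ be positive integers and let $S=\{u_1,\ldots,u_k\}\subseteq\mathbb{R}^n$ be a finite set of cardinality $k$ such that the $k\times k$ matrix $X_0=\big[[u_1]_{\mathbb{B}_0}\ \cdots\ [u_k]_{\mathbb{B}_0}\big]$ is nonsingular. Let $X_1=\big[[u_1]_{\mathbb{B}_1}\ \cdots\ [u_k]_{\mathbb{B}_1}\big]$ and $G=X_0^{-T}X_1^T\in\mathbb{R}^{\mathbb{B}_0\times\mathbb{B}_1}$. Then the ideal of $\mathbb{R}[x]$ generated by the polynomials $\varphi[G,\alpha]$ ($\alpha\in\mathbb{B}_1$) equals the vanishing ideal of $S$, i.e., $$\mathrm{Ideal}(\varphi[G])=\{h\in\mathbb{R}[x]:\ h\equiv 0\ \text{on}\ S\}.$$ In particular, if a polynomial $h\in\mathbb{R}[x]$ vanishes identically on $S$, then there are polynomials $q_\alpha\in\mathbb{R}[x]$ ($\alpha\in\mathbb{B}_1$) such that $$h=\sum_{\alpha\in\mathbb{B}_1}q_\alpha\,\varphi[G,\alpha],\qquad \deg(q_\alpha)+|\alpha|\le\deg(h)\quad(\alpha\in\mathbb{B}_1).$$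
   Context: Notation: $x=(x_1,\ldots,x_n)$, $x^\alpha=x_1^{\alpha_1}\cdots x_n^{\alpha_n}$ and $|\alpha|=\alpha_1+\cdots+\alpha_n$ for $\alpha\in\mathbb{N}^n$, where $\mathbb{N}$ includes $0$; $e_i$ is the $i$th standard unit vector. $\mathbb{B}_0\subseteq\mathbb{N}^n$ is the set of the first $k$ vectors of $\mathbb{N}^n$ in the graded lexicographic ordering $0,e_1,\ldots,e_n,2e_1,e_1+e_2,\ldots$ (that is, $\alpha$ comes before $\beta$ if $|\alpha|<|\beta|$, or if $|\alpha|=|\beta|$ and the leftmost nonzero entry of $\alpha-\beta$ is positive). $\mathbb{B}_1=\big((e_1+\mathbb{B}_0)\cup\cdots\cup(e_n+\mathbb{B}_0)\big)\setminus\mathbb{B}_0$. For $i=0,1$, $[x]_{\mathbb{B}_i}=(x^\alpha)_{\alpha\in\mathbb{B}_i}$ is the column vector of monomials with exponents in $\mathbb{B}_i$, and $[u]_{\mathbb{B}_i}$ is its value at $x=u$. For a matrix $G=(G(\beta,\alpha))$ with rows indexed by $\beta\in\mathbb{B}_0$ and columns indexed by $\alpha\in\mathbb{B}_1$, define for $\alpha\in\mathbb{B}_1$ $$\varphi[G,\alpha](x)=x^\alpha-\sum_{\beta\in\mathbb{B}_0}G(\beta,\alpha)x^\beta,$$ and $\varphi[G]=(\varphi[G,\alpha])_{\alpha\in\mathbb{B}_1}$. $X_0^{-T}$ denotes the transpose of the inverse of $X_0$. The degree of the zero polynomial is taken as $-\infty$. *)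

(* Defs.v *)
From mathcomp Require Import all_boot all_order all_algebra.
From mathcomp Require Import mpoly.
From mathcomp Require Import boolp classical_sets reals constructive_ereal.

Set Implicit Arguments.
Unset Strict Implicit.
Unset Printing Implicit Defensive.

Import Order.TTheory GRing.Theory Num.Theory.

Local Open Scope classical_set_scope.
Local Open Scope ring_scope.

(* The order on 'X_{1..n} provided by mpoly cannot be used here: within a fixed
   degree it puts 'U_(n) first, whereas the ordering below is
   0, e_1, ..., e_n, 2 e_1, e_1 + e_2, ... *)
Definition grlex_lt (n : nat) (a b : 'X_{1..n}) : bool :=
  (mdeg a < mdeg b)%N ||
  ((mdeg a == mdeg b) &&
   [exists i : 'I_n,
      (b i < a i)%N && [forall j : 'I_n, (j < i)%N ==> (a j == b j)]]).

Definition grlex_le (n : nat) (a b : 'X_{1..n}) : bool :=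
  (a == b) || grlex_lt a b.

(* For n > 0 there are at least k monomials of degree < k, so the first k
   elements of N^n all have degree < k; see size_B0 and B0_initial. *)
Definition B0 (n k : nat) : seq 'X_{1..n} :=
  take k (sort (@grlex_le n) [seq bmnm m | m : 'X_{1..n < k}]).

Definition B1 (n k : nat) : seq 'X_{1..n} :=
  [seq m <- undup [seq (U_(i) + b)%MM | i <- enum 'I_n, b <- B0 n k]
     | m \notin B0 n k].

Section GradedLex.
Variable n : nat.
Implicit Types a b c : 'X_{1..n}.

Lemma grlex_lt_irr a : grlex_lt a a = false.
Proof.
rewrite /grlex_lt ltnn eqxx /=; apply/negbTE/existsPn => i.
by rewrite ltnn.
Qed.

Lemma grlex_lt_trans : transitive (@grlex_lt n).
Proof.
move=> b a c /orP[ab|/andP[/eqP ab /existsP[i /andP[abi /forallP abj]]]]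
  /orP[bc|/andP[/eqP bc /existsP[i' /andP[bci /forallP bcj]]]];
  rewrite /grlex_lt.
- by rewrite (ltn_trans ab bc).
- by rewrite -bc ab.
- by rewrite ab bc.
rewrite ab bc eqxx orbC /=; apply/orP; left; apply/existsP.
case: (ltngtP i i') => ii'.
- exists i; have /implyP/(_ ii')/eqP <- := bcj i.
  rewrite abi; apply/forallP => j; apply/implyP => ji.
  have /implyP/(_ ji)/eqP -> := abj j.
  by have /implyP/(_ (ltn_trans ji ii')) := bcj j.
- exists i'; have /implyP/(_ ii')/eqP -> := abj i'.
  rewrite bci; apply/forallP => j; apply/implyP => ji.
  have /implyP/(_ (ltn_trans ji ii'))/eqP -> := abj j.
  by have /implyP/(_ ji) := bcj j.
- move/val_inj: ii' bci bcj => <- bci bcj.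
  exists i; rewrite (ltn_trans bci abi); apply/forallP => j.
  apply/implyP => ji; have /implyP/(_ ji)/eqP -> := abj j.
  by have /implyP/(_ ji) := bcj j.
Qed.

Lemma grlex_le_refl : reflexive (@grlex_le n).
Proof. by move=> a; rewrite /grlex_le eqxx. Qed.

Lemma grlex_le_trans : transitive (@grlex_le n).
Proof.
move=> b a c /orP[/eqP->//|ab] /orP[/eqP<-|bc]; apply/orP; right => //.
exact: grlex_lt_trans bc.
Qed.

Lemma grlex_le_anti : antisymmetric (@grlex_le n).
Proof.
move=> a b /andP[/orP[/eqP//|ab] /orP[/eqP//|ba]].
by have := grlex_lt_trans ab ba; rewrite grlex_lt_irr.
Qed.

Lemma grlex_le_total : total (@grlex_le n).
Proof.
move=> a b; rewrite /grlex_le /grlex_lt.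
case: (ltngtP (mdeg a) (mdeg b)) => [||_] /=; rewrite ?orbT //.
case: (eqVneq a b) => //= /eqP neq_ab.
have [i abi] : exists i, a i != b i.
  apply/existsP; apply: contra_notT neq_ab => /existsPn ab.
  by apply/mnmP => i; apply/eqP; rewrite -[_ == _]negbK; apply: ab.
case: (@arg_minnP _ i (fun j => a j != b j) (@nat_of_ord n) abi)
  => {abi}i abi imin.
have eqj (j : 'I_n) : (j < i)%N -> a j == b j.
  by move=> ji; apply: contraLR ji => /imin; rewrite -leqNgt.
move: abi; rewrite neq_ltn => /orP[h|h]; apply/orP;
  [right|left]; apply/existsP; exists i; rewrite h;
  apply/forallP => j; apply/implyP => /eqj //.
by rewrite eq_sym.
Qed.

Variable k : nat.

Lemma mem_bounded a :
  (a \in [seq bmnm m | m : 'X_{1..n < k}]) = (mdeg a < k)%N.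
Proof.
apply/mapP/idP => [[m _ ->]|ak]; first exact: bmdeg.
by exists (BMultinom ak); rewrite ?mem_enum.
Qed.

Lemma B0_uniq : uniq (B0 n k).
Proof.
apply: take_uniq; rewrite sort_uniq map_inj_uniq ?enum_uniq //.
exact: val_inj.
Qed.

Lemma size_B0 : (0 < n)%N -> size (B0 n k) = k.
Proof.
move=> n_gt0; apply: size_takel; rewrite size_sort.
pose f (i : 'I_k) : 'X_{1..n} := (U_(Ordinal n_gt0) *+ i)%MM.
have fE i : mdeg (f i) = i by rewrite mdegMn mdeg1 mul1n.
rewrite -{1}(card_ord k) -(size_image f) uniq_leq_size //.
  rewrite map_inj_uniq ?enum_uniq // => i j fij.
  by apply: val_inj; rewrite /= -fE fij fE.
by move=> _ /mapP[i _ ->]; rewrite mem_bounded fE.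
Qed.

Lemma B0_initial a b : a \in B0 n k -> grlex_lt b a -> b \in B0 n k.
Proof.
move=> aB ba; set s := sort (@grlex_le n) [seq bmnm m | m : 'X_{1..n < k}].
have s_sorted : sorted (@grlex_le n) s := sort_sorted grlex_le_total _.
have as_ : a \in s by apply: mem_take aB.
have ak : (mdeg a < k)%N by rewrite -mem_bounded -(mem_sort (@grlex_le n)).
have bs : b \in s.
  rewrite mem_sort mem_bounded; apply: leq_ltn_trans ak.
  by case/orP: ba => [/ltnW//|/andP[/eqP->]].
rewrite in_take //; apply: leq_ltn_trans (_ : index a s < k)%N; last first.
  by rewrite -in_take.
rewrite leqNgt; apply/negP => ab.
have := sorted_ltn_index grlex_le_trans s_sorted a b as_ bs ab.
move=> /orP[/eqP eab|]; first by rewrite eab grlex_lt_irr in ba.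
by move/(grlex_lt_trans ba); rewrite grlex_lt_irr.
Qed.

Lemma B1_uniq : uniq (B1 n k).
Proof. by rewrite filter_uniq ?undup_uniq. Qed.

End GradedLex.


(* The matrix [[u_1]_B ... [u_k]_B], where B consists of the first m monomials
   of s. Index sets B0 and B1 are represented by positions in the lists:
   'I_k for B0 (legitimate by size_B0) and 'I_(size (B1 n k)) for B1. *)
Definition evalmx (R : realType) (n k m : nat) (s : seq 'X_{1..n})
    (u : 'I_k -> 'rV[R]_n) : 'M[R]_(m, k) :=
  \matrix_(i < m, j < k) ('X_[nth 0%MM s i] : {mpoly R[n]}).@[u j 0].

Definition X0 (R : realType) (n k : nat) (u : 'I_k -> 'rV[R]_n) : 'M[R]_k :=
  evalmx k (B0 n k) u.

Definition X1 (R : realType) (n k : nat) (u : 'I_k -> 'rV[R]_n) :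
    'M[R]_(size (B1 n k), k) :=
  evalmx (size (B1 n k)) (B1 n k) u.

Definition phi (R : realType) (n k : nat) (G : 'M[R]_(k, size (B1 n k)))
    (j : 'I_(size (B1 n k))) : {mpoly R[n]} :=
  'X_[nth 0%MM (B1 n k) j] - \sum_(i < k) G i j *: 'X_[nth 0%MM (B0 n k) i].

Definition ideal_gen (A : comNzRingType) (m : nat) (f : 'I_m -> A) : set A :=
  [set h | exists q : 'I_m -> A, h = \sum_(i < m) q i * f i].

Definition vanishing_ideal (R : realType) (n : nat) (S : set 'rV[R]_n) :
    set {mpoly R[n]} :=
  [set h | forall x, S x -> h.@[x 0] = 0].

(* msize is the degree plus one, and 0 for the zero polynomial. *)
Definition mpdeg (R : realType) (n : nat) (p : {mpoly R[n]}) : \bar int :=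
  if p == 0 then -oo%E else ((msize p).-1%:Z)%:E.

(* Main.v *)
(* Division with remainder: a monomial outside B0 is a multiple of some
   alpha in B1, and subtracting the same multiple of phi[G, alpha] replaces it
   by a combination of monomials that are smaller in the graded lexicographic
   order, since alpha exceeds every element of B0.  Hence every h is a
   combination of the phi[G, alpha], with no increase of degree, plus a
   remainder in the span of B0.  The choice of G makes each phi[G, alpha]
   vanish on S, so the remainder of an h vanishing on S vanishes there too,
   and is then zero because X0 is nonsingular. *)
Require Import Defs.
From mathcomp Require Import all_boot all_order all_algebra.
From mathcomp Require Import mpoly.
From mathcomp Require Import boolp classical_sets reals constructive_ereal.

Set Implicit Arguments.
Unset Strict Implicit.
Unset Printing Implicit Defensive.

Import Order.TTheory GRing.Theory Num.Theory.

Local Open Scope classical_set_scope.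
Local Open Scope ring_scope.

Section GradedLexOrder.
Variable n : nat.
Implicit Types a b c : 'X_{1..n}.

Lemma grlex_lt_mdeg a b : grlex_lt a b -> (mdeg a <= mdeg b)%N.
Proof. by case/orP => [/ltnW//|/andP[/eqP-> _]]. Qed.

Lemma grlex_lt_add2l c a b : grlex_lt a b -> grlex_lt (c + a)%MM (c + b)%MM.
Proof.
rewrite /grlex_lt !mdegD ltn_add2l eqn_add2l.
case/orP => [->//|/andP[-> /existsP[i /andP[ab /forallP eq_ab]]]] /=.
apply/orP; right; apply/existsP; exists i; rewrite !mnmDE ltn_add2l ab.
by apply/forallP => j; rewrite !mnmDE eqn_add2l.
Qed.

(** The order is well-founded because a monomial has only finitely many predecessors: none exceeds
    it in degree. *)
Lemma grlex_lt_ind (P : 'X_{1..n} -> Prop) :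
  (forall a, (forall b, grlex_lt b a -> P b) -> P a) -> forall a, P a.
Proof.
(* The degree bound [d] is fixed once, so that [below] lives in one finite type. Passing from [a] to
   a smaller [b] loses at least [b] itself from [below a], so the cardinality drops. *)
move=> IH a; move: {2}(mdeg a).+1 (ltnSn (mdeg a)) => d.
pose below c := [set m : 'X_{1..n < d} | grlex_lt m c]%SET.
elim: {a}#|below a|.+1 {-2}a (ltnSn #|below a|) => // s IHs a.
rewrite ltnS => le_s lt_d; apply: IH => b ba.
have bd : (mdeg b < d)%N by apply: leq_ltn_trans (grlex_lt_mdeg ba) lt_d.
apply: IHs => //; apply: leq_trans le_s; apply: proper_card.
apply/properP; split.
  by apply/fintype.subsetP => m; rewrite !inE => /grlex_lt_trans; apply.
by exists (BMultinom bd); rewrite !inE //= grlex_lt_irr.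
Qed.

Variable k : nat.

Lemma B0_grlex_lt a b : a \in B0 n k -> b \notin B0 n k -> grlex_lt a b.
Proof.
move=> aB bB; have /orP[] := grlex_le_total a b => /orP[/eqP eab|//].
- by rewrite -eab aB in bB.
- by rewrite eab aB in bB.
- by move=> /(B0_initial aB) bB'; rewrite bB' in bB.
Qed.

Hypotheses (n_gt0 : (0 < n)%N) (k_gt0 : (0 < k)%N).

Lemma B0_mnm0 : 0%MM \in B0 n k.
Proof.
have aB : nth 0%MM (B0 n k) 0 \in B0 n k by rewrite mem_nth ?size_B0.
have [<-//|a_neq0] := eqVneq (nth 0%MM (B0 n k) 0) 0%MM.
apply: B0_initial aB _; rewrite /grlex_lt mdeg0.
by rewrite lt0n mdeg_eq0 a_neq0.
Qed.

Lemma B1_notin_B0 a : a \in B1 n k -> a \notin B0 n k.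
Proof. by rewrite mem_filter => /andP[]. Qed.

(** Lower a nonzero exponent of [a] by one. If the result lies in [B0], then [a] itself is in [B1];
    otherwise a divisor of the result, given by induction on the degree, also divides [a]. Degree
    zero cannot occur, as [B0] contains the zero exponent. *)
Lemma B1_lepm a : a \notin B0 n k ->
  exists2 b, b \in B1 n k & (b <= a)%MM.
Proof.
elim: {a}(mdeg a) {-2}a (erefl (mdeg a)) => [|d IHd] a.
  by move/eqP; rewrite mdeg_eq0 => /eqP->; rewrite B0_mnm0.
move=> da aB; have [i ai] : exists i, a i != 0%N.
  apply/existsP; apply: contraT => /existsPn a0.
  suff a_eq0 : a = 0%MM by rewrite a_eq0 mdeg0 in da.
  by apply/mnmP => i; rewrite mnm0E; apply/eqP; have := a0 i; rewrite negbK.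
have Uia : (U_(i) <= a)%MM.
  by apply/mnm_lepP => j; rewrite mnm1E; case: eqP => // <-; rewrite lt0n.
have aE := submK Uia.
have [a'B|a'B] := boolP ((a - U_(i))%MM \in B0 n k).
  exists a; last exact: lepm_refl.
  rewrite mem_filter aB mem_undup -aE addmC; apply/allpairsP.
  by exists (i, (a - U_(i))%MM); rewrite mem_enum.
have /IHd/(_ a'B)[b bB1 ba'] : mdeg (a - U_(i))%MM = d.
  by apply/eqP; rewrite -eqSS -da -{2}aE mdegD mdeg1 addn1.
exists b => //; apply: lepm_trans ba' _.
by rewrite -{2}aE lem_addr.
Qed.

End GradedLexOrder.

Section Division.
Variables (R : realType) (n k : nat).
Hypotheses (n_gt0 : (0 < n)%N) (k_gt0 : (0 < k)%N).
Variable G : 'M[R]_(k, size (B1 n k)).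

(* Truncated subtraction makes the bound say that q j = 0 as soon as alpha_j has
   degree at least d, which is the convention deg 0 = -oo. *)
Definition reducible (d : nat) (p : {mpoly R[n]}) : Prop :=
  exists (q : 'I_(size (B1 n k)) -> {mpoly R[n]}) (c : 'I_k -> R),
    p = \sum_j q j * phi G j + \sum_i c i *: 'X_[nth 0%MM (B0 n k) i] /\
    forall j, (msize (q j) <= d - mdeg (nth 0%MM (B1 n k) j))%N.

Lemma reducible0 d : reducible d 0.
Proof.
exists (fun=> 0), (fun=> 0); split=> [|j]; last by rewrite msize0.
by rewrite !big1 ?addr0 // => i _; rewrite ?mul0r ?scale0r.
Qed.

Lemma reducibleD d p1 p2 :
  reducible d p1 -> reducible d p2 -> reducible d (p1 + p2).
Proof.
move=> [q1 [c1 [-> le1]]] [q2 [c2 [-> le2]]].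
exists (fun j => q1 j + q2 j), (fun i => c1 i + c2 i); split=> [|j].
  rewrite addrACA -!big_split; congr (_ + _); apply: eq_bigr => i _.
    by rewrite mulrDl.
  by rewrite scalerDl.
by apply: leq_trans (msizeD_le _ _) _; rewrite geq_max le1 le2.
Qed.

Lemma reducibleZ d a p : reducible d p -> reducible d (a *: p).
Proof.
move=> [q [c [-> le_q]]].
exists (fun j => a *: q j), (fun i => a * c i); split=> [|j].
  rewrite scalerDr !scaler_sumr; congr (_ + _); apply: eq_bigr => i _.
    by rewrite scalerAl.
  by rewrite scalerA.
exact: leq_trans (msizeZ_le _ _) (le_q j).
Qed.

Lemma reducible_sum d (I : eqType) (r : seq I) (F : I -> {mpoly R[n]}) :
  (forall i, i \in r -> reducible d (F i)) -> reducible d (\sum_(i <- r) F i).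
Proof.
move=> redF; rewrite big_seq; apply: big_ind => //; first exact: reducible0.
by move=> p1 p2; apply: reducibleD.
Qed.

Lemma reducible_le d d' p : (d <= d')%N -> reducible d p -> reducible d' p.
Proof.
move=> le_d [q [c [-> le_q]]]; exists q, c; split=> // j.
exact: leq_trans (le_q j) (leq_sub2r _ le_d).
Qed.

(** All quotients are zero here, so any bound [d] will do. *)
Lemma reducible_B0 d a : a \in B0 n k -> reducible d 'X_[a].
Proof.
move=> aB; have ak : (index a (B0 n k) < k)%N.
  by rewrite -{2}(size_B0 k n_gt0) index_mem.
exists (fun=> 0), (fun i => (i == Ordinal ak)%:R); split=> [|j].
  rewrite big1 => [|j _]; last by rewrite mul0r.
  rewrite add0r (bigD1 (Ordinal ak)) //= eqxx scale1r nth_index //.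
  by rewrite big1 ?addr0 // => i /negbTE->; rewrite scale0r.
by rewrite msize0.
Qed.

Lemma reducible_mul_phi c (j : 'I_(size (B1 n k))) :
  reducible (mdeg c + mdeg (nth 0%MM (B1 n k) j)).+1 ('X_[c] * phi G j).
Proof.
exists (fun j' => if j' == j then 'X_[c] else 0), (fun=> 0); split=> [|j'].
  rewrite [X in _ + X]big1 => [|i _]; last by rewrite scale0r.
  rewrite addr0 (bigD1 j) //= eqxx big1 ?addr0 // => i /negbTE->.
  by rewrite mul0r.
have [->|_] := eqVneq j' j; last by rewrite msize0.
(* ['X_[c]] has [msize] equal to [(mdeg c).+1], exactly what the bound leaves after the
   subtraction. *)
by rewrite msizeX -addSn addnK.
Qed.

Lemma reducible_mnm a : reducible (mdeg a).+1 'X_[a].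
Proof.
elim/grlex_lt_ind: a => a IHa.
have [|aB] := boolP (a \in B0 n k); first exact: reducible_B0.
have [b bB1 ba] := B1_lepm n_gt0 k_gt0 aB.
have bs : (index b (B1 n k) < size (B1 n k))%N by rewrite index_mem.
pose j := Ordinal bs; have bE : nth 0%MM (B1 n k) j = b by apply: nth_index.
have aE := submK ba; set c := (a - b)%MM in aE.
have -> : 'X_[a] = 'X_[c] * phi G j
    + \sum_(i < k) G i j *: 'X_[(c + nth 0%MM (B0 n k) i)%MM] :> {mpoly R[n]}.
  rewrite /phi bE mulrBr -mpolyXD aE mulr_sumr -addrA addrC.
  rewrite -sumrN -big_split big1 ?add0r //= => i _.
  by rewrite -scalerAr -mpolyXD addNr.
apply: reducibleD.
  by have := reducible_mul_phi c j; rewrite bE -mdegD aE.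
apply: reducible_sum => i _; apply: reducibleZ.
(* Elements of [B0] precede [b], and translation by [c] preserves the order. The new monomials thus
   fall under the induction hypothesis, and their degrees do not exceed that of [a]. *)
have lt_a : grlex_lt (c + nth 0%MM (B0 n k) i)%MM a.
  rewrite -aE; apply: grlex_lt_add2l; apply: B0_grlex_lt (B1_notin_B0 bB1).
  by rewrite mem_nth ?size_B0.
by apply: reducible_le (IHa _ lt_a); rewrite ltnS grlex_lt_mdeg.
Qed.

Lemma reducible_msize p : reducible (msize p) p.
Proof.
rewrite {2}(mpolyE p); apply: reducible_sum => m mp; apply: reducibleZ.
exact: reducible_le (msize_mdeg_lt mp) (reducible_mnm m).
Qed.

End Division.

Section Interpolation.
Variables (R : realType) (n k : nat) (u : 'I_k -> 'rV[R]_n).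
Hypothesis X0_unit : X0 u \in unitmx.

Lemma phi_eval0 j l :
  (phi ((invmx (X0 u))^T *m (X1 u)^T) j).@[u l 0] = 0.
Proof.
(* Entry (j, l) of this identity says that the monomial of [B1] at position [j] and its
   [G]-combination of [B0] monomials agree at [u l]. *)
set G := (X in phi X); have : X1 u = G^T *m X0 u.
  by rewrite /G trmx_mul !trmxK mulmxKV.
move=> /matrixP/(_ j l); rewrite !mxE => X1E.
rewrite /phi mevalB X1E; apply/eqP; rewrite subr_eq0 raddf_sum; apply/eqP.
by apply: eq_bigr => i _; rewrite /= mevalZ !mxE.
Qed.

Lemma B0_span_eval0 (c : 'I_k -> R) :
  (forall l, (\sum_i c i *: 'X_[nth 0%MM (B0 n k) i]).@[u l 0] = 0) ->
  forall i, c i = 0.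
Proof.
move=> c0 i; suff : (\row_i c i) = 0 by move/rowP/(_ i); rewrite !mxE.
(* The row of coefficients times [X0 u] is the row of values at the points, which is zero. *)
rewrite -(mulmxK X0_unit (\row_i c i)).
suff -> : (\row_i c i) *m X0 u = 0 by rewrite mul0mx.
apply/rowP => l; rewrite !mxE -{2}(c0 l) raddf_sum.
by apply: eq_bigr => i' _; rewrite /= mevalZ !mxE.
Qed.

End Interpolation.

(** If [q] is zero, the left side is [-oo]. Otherwise [msize q] is positive, which forces
    [d < msize p]: the subtraction is not truncated, [p] is nonzero, and both degrees are finite. *)
Lemma mpdeg_addr_le (R : realType) (n d : nat) (p q : {mpoly R[n]}) :
  (msize q <= msize p - d)%N -> (mpdeg q + (d%:Z)%:E <= mpdeg p)%E.
Proof.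
rewrite /mpdeg; have [_ _|q_neq0 le_qp] := eqVneq q 0; first exact: leNye.
have q_gt0 : (0 < msize q)%N by rewrite lt0n msize_poly_eq0.
have d_lt : (d < msize p)%N by rewrite -subn_gt0 (leq_trans q_gt0).
have [p0|_] := eqVneq p 0; first by rewrite p0 msize0 in d_lt.
rewrite -EFinD lee_fin -PoszD lez_nat -!subn1 addnBAC // leq_sub2r //.
by rewrite -(subnK (ltnW d_lt)) leq_add2r.
Qed.

Theorem theorem3p3 (R : realType) (n k : nat) (n_gt0 : (0 < n)%N)
    (k_gt0 : (0 < k)%N) (u : 'I_k -> 'rV[R]_n) (u_inj : injective u)
    (X0_unit : X0 u \in unitmx) :
  let S : set 'rV[R]_n := range u in
  let G : 'M[R]_(k, size (B1 n k)) := (invmx (X0 u))^T *m (X1 u)^T in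
  ideal_gen (phi G) = vanishing_ideal S /\
  (forall h : {mpoly R[n]}, (forall x, S x -> h.@[x 0] = 0) ->
     exists q : 'I_(size (B1 n k)) -> {mpoly R[n]},
       h = \sum_(j < size (B1 n k)) q j * phi G j /\
       forall j : 'I_(size (B1 n k)),
         (mpdeg (q j) + ((mdeg (nth 0%MM (B1 n k) j))%:Z)%:E <= mpdeg h)%E).
Proof.
move=> S G.
have ideal0 q l : (\sum_j q j * phi G j).@[u l 0] = 0.
  by rewrite raddf_sum big1 // => j _; rewrite /= mevalM phi_eval0 // mulr0.
have main h : (forall x, S x -> h.@[x 0] = 0) ->
    exists q : 'I_(size (B1 n k)) -> {mpoly R[n]},
      h = \sum_j q j * phi G j /\
      forall j, (mpdeg (q j) + ((mdeg (nth 0%MM (B1 n k) j))%:Z)%:E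
                 <= mpdeg h)%E.
  move=> h0; have [q [c [hE le_q]]] := reducible_msize n_gt0 k_gt0 G h.
  exists q; split=> [|j]; last exact: mpdeg_addr_le.
  (* At each [u l], both [h] and the combination of the [phi G j] vanish, hence so does the
     remainder. *)
  have c0 : forall i, c i = 0.
    apply: B0_span_eval0 X0_unit _ _ => l.
    have := h0 (u l) (ex_intro2 _ _ l I erefl).
    by rewrite hE mevalD ideal0 add0r.
  by rewrite {1}hE [X in _ + X]big1 ?addr0 // => i _; rewrite c0 scale0r.
split=> //; apply/seteqP; split=> [h [q ->] _ [l _ <-]|h /main[q [hE _]]].
  exact: ideal0.
by exists q.
Qed.
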